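(* Let $\theta>0$, let $0<\underline\rho\le\bar\rho<1$, and let $(\rho_\ell)_{\ell\ge1}$ be the lag-$\ell$ autocorrelations of a stationary real-valued process with finite positive variance, satisfying $\underline\rho^{\,\ell}\le\rho_\ell\le\bar\rho^{\,\ell}$ for all $\ell\ge1$. Then for all positive integers $r,s$, $$\frac{s+\theta}{r+\theta}\cdot\frac{1+\underline\rho^{\,s}}{1-\underline\rho^{\,s}}\cdot\frac{1-\bar\rho^{\,r}}{1+\bar\rho^{\,r}}\;\le\;\mathrm{eff}(r,s)\;\le\;\frac{s+\theta}{r+\theta}\cdot\frac{1+\bar\rho^{\,s}}{1-\bar\rho^{\,s}}\cdot\frac{1-\underline\rho^{\,r}}{1+\underline\rho^{\,r}}.$$
   Context: For positive integers $r,s$, the efficiency of thinning by factor $r$ versus thinning by factor $s$, when advancing the chain costs one unit and evaluating the function costs $\theta$ units, is $$\mathrm{eff}(r,s)=\frac{s+\theta}{r+\theta}\cdot\frac{1+2\sum_{\ell=1}^\infty\rho_{s\ell}}{1+2\sum_{\ell=1}^\infty\rho_{r\ell}}.$$ *)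

(* Defs.v *)
From HB Require Import structures.
From mathcomp Require Import all_boot all_order all_algebra.
From mathcomp Require Import all_classical all_reals all_analysis.
Import Order.TTheory GRing.Theory Num.Theory.
Import numFieldNormedType.Exports.
Set Implicit Arguments.
Unset Strict Implicit.
Unset Printing Implicit Defensive.
Local Open Scope classical_set_scope.
Local Open Scope ring_scope.

(* Stationarity in the wide sense, the notion under which autocorrelations are
   defined. It is implied by invariance of the finite-dimensional laws under
   time shifts together with finite second moments. *)
Definition stationary (d : measure_display) (T : measurableType d)
    (R : realType) (P : probability T R) (X : nat -> {RV P >-> R}) : Prop :=
  [/\ forall i, (X i : T -> R) \in Lfun P 2%:E,
      forall i, ('E_P[X i] = 'E_P[X 0%N])%E
    & forall i l, covariance P (X i) (X (i + l)%N) =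
                  covariance P (X 0%N) (X l)].

Definition autocorrelation (d : measure_display) (T : measurableType d)
    (R : realType) (P : probability T R) (X : nat -> {RV P >-> R})
    (l : nat) : R :=
  fine (covariance P (X 0%N) (X l)) / fine 'V_P[X 0%N].

(* The sums are limits in R, which are meaningful only when the series
   converge. *)
Definition eff (R : realType) (theta : R) (rho : nat -> R) (r s : nat) : R :=
  (s%:R + theta) / (r%:R + theta) *
  ((1 + 2 * \big[+%R/0]_(1 <= l <oo) rho (s * l)%N) /
   (1 + 2 * \big[+%R/0]_(1 <= l <oo) rho (r * l)%N)).

(* Main.v *)
Require Import Defs.
From mathcomp Require Import all_boot all_order all_algebra.
From mathcomp Require Import all_classical all_reals all_analysis.
From mathcomp Require Import ring.
Import Order.TTheory GRing.Theory Num.Theory.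
Import numFieldNormedType.Exports.
Local Open Scope ring_scope.

(** Thinning by [k] replaces the lag-[l] autocorrelation by the one at lag [k * l], which lies
    between the [l]-th powers of [rho_lo ^+ k] and [rho_hi ^+ k]. Comparison with geometric series
    ([autocorrelation_time_bounds]) confines [1 + 2 * sum] between the values of (1 + z) / (1 - z)
    at these two ratios. All these quantities are positive, so in the quotient [eff] the lower bound
    pairs the least numerator with the greatest denominator, and the upper bound does the
    reverse. *)

Lemma lim_sum1_series (R : realType) (u : nat -> R) :
  cvgn (series (fun l => u l.+1)) ->
  \big[+%R/0]_(1 <= l <oo) u l = limn (series (fun l => u l.+1)).
Proof.
move=> cu; apply/cvg_lim; first exact: Rhausdorff.
rewrite -cvg_shiftS /=.
under eq_fun do rewrite big_add1.
exact: cu.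
Qed.

Lemma twice_geometric_sum (R : realType) (z : R) :
  z < 1 -> 1 + 2 * (z / (1 - z)) = (1 + z) / (1 - z).
Proof. by move=> z1; field; rewrite subr_eq0 gt_eqF. Qed.

(** Domination by the geometric series of ratio [b] makes the sum a genuine limit; termwise
    inequalities then pass to the limits. *)
Lemma autocorrelation_time_bounds (R : realType) (u : nat -> R) (a b : R) :
  0 <= a -> a < 1 -> 0 <= b -> b < 1 ->
  (forall l, (1 <= l)%N -> a ^+ l <= u l <= b ^+ l) ->
  (1 + a) / (1 - a) <= 1 + 2 * \big[+%R/0]_(1 <= l <oo) u l
                    <= (1 + b) / (1 - b).
Proof.
move=> a0 a1 b0 b1 hu.
(* First term and ratio are both [z]: index [l] carries [z ^+ l.+1], matching the sum that starts at
   lag 1. *)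
have geo (z : R) : 0 <= z -> z < 1 ->
    (series (geometric z z) n @[n --> \oo] --> z / (1 - z))%classic.
  by move=> z0 z1; apply: cvg_geometric_series; rewrite ger0_norm.
have geoE (z : R) l : geometric z z l = z ^+ l.+1 by rewrite /= exprS.
have cvg_geo (z : R) : 0 <= z -> z < 1 -> cvgn (series (geometric z z)).
  by move=> z0 z1; apply/cvg_ex; exists (z / (1 - z)); exact: geo.
have lim_geo (z : R) : 0 <= z -> z < 1 -> limn (series (geometric z z)) = z / (1 - z).
  by move=> z0 z1; apply/cvg_lim; [exact: Rhausdorff | exact: geo].
have lo l : geometric a a l <= u l.+1 by rewrite geoE; case/andP: (hu l.+1 isT).
have hi l : u l.+1 <= geometric b b l by rewrite geoE; case/andP: (hu l.+1 isT).
have cu : cvgn (series (fun l => u l.+1)).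
  apply: series_le_cvg hi (cvg_geo b b0 b1) => l.
    by apply: le_trans (lo l); rewrite geoE exprn_ge0.
  by rewrite geoE exprn_ge0.
rewrite lim_sum1_series // -!twice_geometric_sum // -!lim_geo //.
rewrite !lerD2l !ler_pM2l //; apply/andP.
by split; apply: lim_series_le => //; exact: cvg_geo.
Qed.

Theorem mainTheorem5 (R : realType) (theta rho_lo rho_hi : R)
    (htheta : 0 < theta)
    (hlo : 0 < rho_lo) (hlohi : rho_lo <= rho_hi) (hhi : rho_hi < 1)
    (d : measure_display) (T : measurableType d) (P : probability T R)
    (X : nat -> {RV P >-> R})
    (hstat : stationary X)
    (hvar : (0 < 'V_P[X 0%N] < +oo)%E)
    (hrho : forall l : nat, (1 <= l)%N ->
       rho_lo ^+ l <= autocorrelation X l <= rho_hi ^+ l)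
    (r s : nat) (hr : (1 <= r)%N) (hs : (1 <= s)%N) :
  (s%:R + theta) / (r%:R + theta) *
    ((1 + rho_lo ^+ s) / (1 - rho_lo ^+ s)) *
    ((1 - rho_hi ^+ r) / (1 + rho_hi ^+ r))
  <= eff theta (autocorrelation X) r s
  <= (s%:R + theta) / (r%:R + theta) *
    ((1 + rho_hi ^+ s) / (1 - rho_hi ^+ s)) *
    ((1 - rho_lo ^+ r) / (1 + rho_lo ^+ r)).
Proof.
have hi0 : 0 < rho_hi by exact: lt_le_trans hlohi.
have lo1 : rho_lo < 1 by exact: le_lt_trans hhi.
(* The exponent is a successor because at exponent 0 the denominator vanishes and the quotient is 0
   by convention. *)
have lo_pos k : 0 < (1 + rho_lo ^+ k.+1) / (1 - rho_lo ^+ k.+1).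
  apply: divr_gt0; first by rewrite addr_gt0 ?exprn_gt0.
  by rewrite subr_gt0 exprn_ilt1 // ltW.
have bounds k : (1 <= k)%N ->
    (1 + rho_lo ^+ k) / (1 - rho_lo ^+ k) <=
    1 + 2 * \big[+%R/0]_(1 <= l <oo) autocorrelation X (k * l)%N <=
    (1 + rho_hi ^+ k) / (1 - rho_hi ^+ k).
  move=> k1; apply: autocorrelation_time_bounds;
    rewrite ?exprn_ge0 ?exprn_ilt1 -?lt0n ?(ltW hlo) ?(ltW hi0) // => l l1.
  by rewrite -!exprM; apply: hrho; rewrite muln_gt0 k1.
case: r s hr hs => [//|r] [//|s] _ _.
have /andP[slo shi] := bounds s.+1 isT; have /andP[rlo rhi] := bounds r.+1 isT.
rewrite /eff.
move: slo shi rlo rhi (lo_pos s) (lo_pos r).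
(* The factors in [r] become inverses of the very bounds known for the sum in the denominator. *)
rewrite -(invf_div (1 + rho_hi ^+ r.+1)) -(invf_div (1 + rho_lo ^+ r.+1)).
set Ss := 1 + 2 * _; set Sr := 1 + 2 * _.
set Ls := (1 + rho_lo ^+ s.+1) / _; set Us := (1 + rho_hi ^+ s.+1) / _.
set Lr := (1 + rho_lo ^+ r.+1) / _; set Ur := (1 + rho_hi ^+ r.+1) / _.
move=> slo shi rlo rhi Ls0 Lr0.
have Sr0 : 0 < Sr by exact: lt_le_trans rlo.
have Ss0 : 0 < Ss by exact: lt_le_trans slo.
have Ur0 : 0 < Ur by exact: lt_le_trans rhi.
have c0 : 0 < (s.+1%:R + theta) / (r.+1%:R + theta).
  by rewrite divr_gt0 ?addr_gt0 ?ltr0n.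
rewrite -(mulrA _ Ls) -(mulrA _ Us) !(ler_pM2l c0).
(* Inversion reverses order on positives, so [Sr <= Ur] serves the lower bound and [Lr <= Sr] the
   upper one. *)
by apply/andP; split; apply: ler_pM; rewrite ?invr_ge0 ?lef_pV2 ?posrE // ltW.
Qed.
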